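(* For every $\gamma > 0$ there exists $n_0$ such that for every $n \geq n_0$ the following holds. Any family of at most $n^{\frac12-\gamma}$ rooted trees, each with at most $(1-\gamma)n$ vertices in either of its two bipartition classes, packs into $K_{n,n}$, with the roots of all the trees embedded in the same part of $K_{n,n}$.
   Context: $K_{n,n}$ is the complete bipartite graph with $n$ vertices in each part. A family $\mathcal H$ of graphs packs into a graph $G$ if $G$ contains pairwise edge-disjoint copies (as not necessarily induced subgraphs) of the members of $\mathcal H$, one copy for each member of the family; copies of different members may share vertices. The bipartition (partition) classes of a tree are the two colour classes of its unique proper $2$-colouring. *)

(* Defs.v *)
From HB Require Import structures.
From mathcomp Require Import all_boot all_order all_algebra.
From mathcomp Require Import reals exp.

Set Implicit Arguments.
Unset Strict Implicit.
Unset Printing Implicit Defensive.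

Record sgraph := SGraph {
  vertex :> finType;
  edge : rel vertex;
  edge_sym : symmetric edge;
  edge_irrefl : irreflexive edge }.

(* A graph cycle is a duplicate-free closed walk of length at least 3; the    *)
(* bound discards [:: x; y] with x and y adjacent, which satisfies ucycle.    *)
Definition acyclic (G : sgraph) : Prop :=
  forall c : seq G, ucycle (@edge G) c -> size c < 3.

Definition connected_graph (G : sgraph) : Prop :=
  forall x y : G, connect (@edge G) x y.

Definition is_tree (G : sgraph) : Prop :=
  [/\ 0 < #|G|, connected_graph G & acyclic G].

Record rooted_tree := RootedTree {
  tree :> sgraph;
  tree_is_tree : is_tree tree;
  root_of : tree }.

Definition proper_2colouring (G : sgraph) (c : G -> bool) : Prop :=
  forall x y : G, edge x y -> c x != c y.

(* Swapping the two colours gives again a proper 2-colouring, so both colour  *)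
(* classes are covered.                                                       *)
Definition bipartition_class (G : sgraph) (A : {set G}) : Prop :=
  exists2 c : G -> bool, proper_2colouring c & A = [set x | c x].

Definition in_left (A B : Type) (v : A + B) : bool :=
  if v is inl _ then true else false.

Definition Knn_edge (n : nat) : rel ('I_n + 'I_n)%type :=
  fun u v => in_left u != in_left v.

Lemma Knn_edge_sym n : symmetric (@Knn_edge n).
Proof. by move=> u v; rewrite /Knn_edge eq_sym. Qed.

Lemma Knn_edge_irrefl n : irreflexive (@Knn_edge n).
Proof. by move=> u; rewrite /Knn_edge eqxx. Qed.

Definition Knn (n : nat) : sgraph :=
  SGraph (@Knn_edge_sym n) (@Knn_edge_irrefl n).

Definition Knn_part (n : nat) (s : bool) : {set Knn n} :=
  [set v : 'I_n + 'I_n | in_left v == s].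

Definition embedding (H G : sgraph) (f : H -> G) : Prop :=
  injective f /\ (forall x y : H, edge x y -> edge (f x) (f y)).

Definition copy_edges (H G : sgraph) (f : H -> G) : {set {set G}} :=
  [set [set f p.1; f p.2] | p : H * H & edge p.1 p.2].

Definition packing (I : finType) (H : I -> sgraph) (G : sgraph)
    (f : forall i, H i -> G) : Prop :=
  (forall i, embedding (f i)) /\
  (forall i j, i != j -> [disjoint copy_edges (f i) & copy_edges (f j)]).

(* Main.v *)
(* The trees are packed one after another. Once fewer than k trees have been  *)
(* packed, at most 2kn edges are used, so for d of order gamma * n at most    *)
(* d vertices on each side have used degree at least d. The next tree avoids  *)
(* these vertices and is embedded greedily from a root, so that every new     *)
(* vertex has a single neighbour, its parent, among the embedded ones: it     *)
(* must avoid at most d vertices of large used degree, fewer than d used      *)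
(* neighbours of its parent, and the vertices already occupied by its colour  *)
(* class; since 2d <= gamma * n, a free place remains.                        *)
Require Import Defs.
From mathcomp Require Import all_boot all_order all_algebra.
From mathcomp Require Import reals exp.
From mathcomp Require Import ring lra zify.

Import Order.TTheory GRing.Theory Num.Theory.

(** A greedy argument works because the trees are too few to fill many places. A tree with at most
    [n] vertices per class has fewer than [2n] edges, so [k <= sqrt n] trees use at most [2 n^(3/2)]
    edges, which is below [d^2] for [d] about [gamma n / 2] and [n] large. By double counting
    ([card_high_degree]) each part then has at most [d] saturated vertices, and the slack
    [gamma n >= 2d] in each colour class pays both for these and for the used edges at the parent
    ([embed_tree_avoiding]). [tree_growth] supplies the order of embedding, and [pack_trees]
    iterates over the family. *)

(** * Trees grown from the root one leaf at a time *)

(** Connectedness gives an edge leaving any proper vertex set that contains [r]; acyclicity makes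
    the new vertex a leaf, with its parent as only neighbour in the set. *)
Lemma tree_growth {G : sgraph} (r : G) (P : {set G} -> Prop) :
    is_tree G -> P [set r] ->
    (forall (S : {set G}) (x y : G), r \in S -> x \in S -> y \notin S ->
       edge x y -> {in S, forall z, edge z y -> z = x} -> P S -> P (y |: S)) ->
  P [set: G].
Proof.
case=> _ Gconn Gacyc P1 Pstep.
(* The connecting path must stay inside [S], so that it misses the new vertex and can be closed into
   a cycle through it. *)
pose linked (S : {set G}) := {in S &, forall x y,
  exists p, [/\ path (@edge G) x p, last x p = y & {subset p <= S}]}.
suff grow m : m < #|G| ->
    exists S : {set G}, [/\ #|S| = m.+1, r \in S, linked S & P S].
  have G_gt0 : 0 < #|G| by apply/card_gt0P; exists r.
  have [|S [cardS _ _ PS]] := grow #|G|.-1; first by rewrite prednK.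
  suff -> : [set: G] = S by [].
  by apply: esym; apply/eqP; rewrite eqEcard subsetT cardsT cardS prednK /=.
elim: m => [|m IHm] m_lt.
  exists [set r]; split; rewrite ?cards1 ?set11 // => x y /set1P-> /set1P->.
  by exists [::].
have [S [cardS rS linkS PS]] := IHm (ltnW m_lt).
have [[x y] /= /andP[/andP[exy xS] yS]|noexit] := pickP
    [pred e : G * G | edge e.1 e.2 && (e.1 \in S) && (e.2 \notin S)]; last first.
  have [z zS] : exists z, z \notin S.
    apply/existsP; rewrite -[[exists _, _]]negbK negb_exists; apply/negP.
    move=> /forallP Sall; have : #|[set: G]| <= #|S|.
      by apply/subset_leq_card/subsetP => z _; have := Sall z; rewrite negbK.
    by rewrite cardsT cardS leqNgt m_lt.
  have /closed_connect Sclosed : closed (@edge G) (mem S).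
    move=> x y exy; have exy' : edge y x by rewrite edge_sym.
    have := noexit (x, y); have := noexit (y, x); rewrite /= exy exy' /=.
    by case: (x \in S); case: (y \in S).
  by have := Sclosed _ _ (Gconn r z); rewrite /= rS (negPf zS).
have uniq_nb : {in S, forall z, edge z y -> z = x}.
  move=> z zS ezy; apply/eqP/negPn/negP => zNx.
  have [p [pathp lastp subp]] := linkS x z xS zS.
  case/shortenP: pathp lastp => q pathq uniqq subq lastq.
  have qS u : u \in q -> u \in S by move=> uq; apply: subp; apply: subq.
  (* A second neighbour [z] of [y] would close the simple path from [x] to [z] into a cycle; the
     size bound forces [q] to be empty, hence [z = x]. *)
  have : size (y :: x :: q) < 3.
    apply: Gacyc; apply/andP; split.
      by rewrite /= rcons_path pathq lastq ezy edge_sym exy.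
    rewrite cons_uniq uniqq andbT inE negb_or; apply/andP; split.
      by apply: contraNneq yS => ->.
    by apply: contra yS => /qS.
  case: q lastq {pathq uniqq subq qS} => //= xz _.
  by rewrite xz eqxx in zNx.
exists (y |: S); split; last exact: (Pstep S x y).
- by rewrite cardsU1 yS cardS.
- by rewrite inE rS orbT.
have sub (p : seq G) : {subset p <= S} -> {subset p <= y |: S}.
  by move=> subp u /subp uS; rewrite inE uS orbT.
move=> a b /setU1P[->|aS] /setU1P[->|bS].
- by exists [::].
- have [p [pathp lastp subp]] := linkS x b xS bS.
  exists (x :: p); split=> //=; first by rewrite edge_sym exy.
  by move=> u; rewrite inE => /predU1P[->|/(sub _ subp)//]; rewrite inE xS orbT.
- have [p [pathp lastp subp]] := linkS a x aS xS.
  exists (rcons p y); split; rewrite ?last_rcons ?rcons_path ?pathp ?lastp //.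
  move=> u; rewrite mem_rcons => /predU1P[->|/(sub _ subp)//].
  by rewrite setU11.
- have [p [pathp lastp /sub subp]] := linkS a b aS bS.
  by exists p.
Qed.

Lemma tree_proper_2colouring {G : sgraph} (r : G) :
  is_tree G -> exists2 c : G -> bool, proper_2colouring c & c r.
Proof.
move=> treeG.
pose P (S : {set G}) := exists2 c : G -> bool,
  {in S &, forall x y, edge x y -> c x != c y} & c r.
suff [c cP cr] : P [set: G] by exists c => // x y; apply: cP; rewrite inE.
apply: (tree_growth r) => //.
  exists xpredT => // x y /set1P-> /set1P->; by rewrite edge_irrefl.
move=> S x y rS xS yS exy nb [c cP cr].
have SNy u : u \in S -> (u == y) = false.
  by move=> uS; apply/negP => /eqP uy; rewrite -uy uS in yS.
exists (fun u => if u == y then ~~ c x else c u); last by rewrite SNy.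
move=> a b /setU1P[->|aS] /setU1P[->|bS]; rewrite ?eqxx ?SNy //.
- by rewrite edge_irrefl.
- by rewrite edge_sym => /nb->//; case: (c x).
- by move=> /nb->//; case: (c x).
- exact: cP.
Qed.

(** Each vertex added after the first brings at most one new edge, the one to its parent. *)
Lemma card_copy_edges {H G : sgraph} (f : H -> G) :
  is_tree H -> #|copy_edges f| < #|H|.
Proof.
move=> treeH; have [/card_gt0P[r _] _ _] := treeH.
pose E (S : {set H}) := [set [set f p.1; f p.2] |
  p : H * H & [&& edge p.1 p.2, p.1 \in S & p.2 \in S]].
have -> : copy_edges f = E [set: H].
  by apply/setP => e; apply/imsetP/imsetP => -[p];
     rewrite !inE ?andbT => ep ->; exists p; rewrite // !inE ?andbT.
rewrite -cardsT; apply: (tree_growth r (fun S => #|E S| < #|S|)) => //.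
  rewrite cards1 ltnS leqn0 cards_eq0; apply/eqP/setP => e; rewrite inE.
  apply/imsetP => -[[a b]]; rewrite inE /= => /and3P[eab].
  by move=> /set1P aE /set1P bE; rewrite aE bE edge_irrefl in eab.
move=> S x y rS xS yS exy nb ltES; rewrite cardsU1 yS add1n ltnS.
apply: leq_trans ltES; apply: (@leq_trans #|[set f x; f y] |: E S|).
  apply/subset_leq_card/subsetP => e /imsetP[[a b]]; rewrite inE /=.
  case/and3P=> eab /setU1P[aE|aS] /setU1P[bE|bS] ->.
  - by rewrite aE bE edge_irrefl in eab.
  - rewrite aE edge_sym in eab *; rewrite (nb b bS eab).
    by apply/setU1P; left; rewrite setUC.
  - by rewrite bE in eab *; rewrite (nb a aS eab) setU11.
  - apply/setU1P; right; apply/imsetP; exists (a, b) => //.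
    by rewrite inE /= eab aS bS.
by rewrite cardsU1; case: (_ \notin _) => //; rewrite add0n.
Qed.

(** * Embedding one tree off the used edges *)

Definition used_nbrs {n : nat} (U : {set {set Knn n}}) (v : Knn n) :=
  [set w : Knn n | edge v w & [set v; w] \in U].

(** Double counting: an edge has exactly one endpoint in the part [s], so the used degrees over this
    part sum to at most [#|U|], without a factor 2. *)
Lemma card_high_degree {n d : nat} (U : {set {set Knn n}}) (s : bool) :
  #|[set v in Knn_part n s | d <= #|used_nbrs U v|]| * d <= #|U|.
Proof.
set B := [set v in _ | _].
pose E := [set p : Knn n * Knn n | (p.1 \in B) && (p.2 \in used_nbrs U p.1)].
have -> : #|B| * d = \sum_(v in B) d by rewrite sum_nat_const.
apply: (@leq_trans (\sum_(v in B) #|used_nbrs U v|)).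
  by apply: leq_sum => v; rewrite inE => /andP[].
apply: (@leq_trans #|E|).
  under eq_bigr do rewrite -sum1_card.
  rewrite pair_big_dep /= sum1dep_card /= subset_leq_card //.
rewrite -(@card_in_imset _ _ (fun p => [set p.1; p.2] : {set Knn n})).
  apply/subset_leq_card/subsetP => e /imsetP[[v w]].
  by rewrite !inE /= => /and3P[_ _ ?] ->.
have side v w : (v, w) \in E -> in_left v = s /\ in_left w = ~~ s.
  rewrite !inE /= => /andP[/andP[/eqP<- _] /andP[]].
  by rewrite /Knn_edge; case: (in_left v); case: (in_left w).
move=> [v w] [v' w'] /side[/= sv sw] /side[/= sv' sw'] eqe.
have : v \in [set v'; w'] by rewrite -eqe set21.
have : w \in [set v'; w'] by rewrite -eqe set22.
case/set2P=> [wE|->]; first by move: sw; rewrite wE sv'; case: (s).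
case/set2P=> [->//|vE]; by move: sv; rewrite vE sw'; case: (s).
Qed.

Lemma embed_tree_avoiding {n d : nat} (U : {set {set Knn n}})
    (T : rooted_tree) :
    0 < d -> #|U| <= d * d ->
    (forall A : {set T}, bipartition_class A -> #|A| + d.*2 <= n) ->
  exists f : T -> Knn n, [/\ embedding f, [disjoint copy_edges f & U],
    f (root_of T) \in Knn_part n true & #|copy_edges f| <= n.*2].
Proof.
move=> d_gt0 leU leA; set r := root_of T.
have treeT := tree_is_tree T.
have [c cP cr] := tree_proper_2colouring r treeT.
have classP s : bipartition_class [set x : T | c x == s].
  exists (fun x => c x == s) => [x y /cP|//].
  by case: (c x); case: (c y); case: (s).
have leclass s := leA _ (classP s).
pose good v := #|used_nbrs U v| < d.
have card_bad s : #|[set v in Knn_part n s | ~~ good v]| <= d.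
  rewrite -(leq_pmul2r d_gt0); apply: leq_trans leU.
  apply: leq_trans (card_high_degree (d := d) U s).
  rewrite leq_pmul2r //; apply/subset_leq_card/subsetP => v.
  by rewrite !inE -leqNgt.
have card_part s : #|Knn_part n s| = n.
  have inj_l : injective (fun i : 'I_n => inl i : Knn n) by move=> ? ? [].
  have inj_r : injective (fun i : 'I_n => inr i : Knn n) by move=> ? ? [].
  rewrite -[RHS]card_ord; case: s.
    rewrite -(card_imset _ inj_l); apply: eq_card => -[i|i]; rewrite !inE /=.
      by rewrite imset_f.
    by apply/esym/imsetP => -[].
  rewrite -(card_imset _ inj_r); apply: eq_card => -[i|i]; rewrite !inE /=.
    by apply/esym/imsetP => -[].
  by rewrite imset_f.
(* [N] will be the set of used neighbours of the image of the parent. *)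
have free (s : bool) (S : {set T}) (g : T -> Knn n) (N : {set Knn n}) (y : T) :
    y \notin S -> c y = s -> #|N| < d ->
  exists w, [/\ in_left w = s, good w, w \notin N &
               {in S, forall x, c x = s -> g x != w}].
  move=> yS cy ltN.
  pose occ := [set g x | x in [set x in S | c x == s]].
  pose bad := [set v in Knn_part n s | ~~ good v].
  (* Strict, because [y] has colour [s] but is not yet embedded. *)
  have lt_occ : #|occ| < #|[set x : T | c x == s]|.
    apply: leq_ltn_trans (leq_imset_card _ _) _; apply: proper_card.
    apply/properP; split; first by apply/subsetP=> x; rewrite !inE => /andP[].
    by exists y; rewrite !inE ?cy ?eqxx // (negPf yS).
  have : ~~ (Knn_part n s \subset occ :|: bad :|: N).
    apply/negP => /subset_leq_card; rewrite card_part.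
    have := cardsU (occ :|: bad) N; have := cardsU occ bad.
    have := card_bad s; have := leclass s; rewrite -/bad; lia.
  case/subsetPn=> w ws; rewrite !inE !negb_or negb_and negbK => /andP[].
  case/andP=> wocc; rewrite inE in ws; rewrite ws /= => wgood wN.
  exists w; split=> // [|x xS cx]; first exact/eqP.
  apply: contraNneq wocc => <-; apply: imset_f.
  by rewrite inE xS cx eqxx.
(* Keeping all images good ensures that the parent of any later vertex has fewer than [d] used
   neighbours. Colours are matched with sides, so the root, coloured [true], lands on the left. *)
pose P (S : {set T}) := exists g : T -> Knn n,
  [/\ {in S &, injective g}, {in S, forall x, in_left (g x) = c x},
      {in S, forall x, good (g x)} &
      {in S &, forall x y, edge x y -> [set g x; g y] \notin U}].
suff [g [ginj gside _ gU]] : P [set: T].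
  exists g; split.
  - split=> [x y|x y exy]; first by apply: ginj; rewrite inE.
    by rewrite /= /Knn_edge !gside ?inE //; apply: cP.
  - apply/pred0P => e /=; apply/negP => /andP[/imsetP[[x y]]].
    by rewrite inE /= => exy ->; apply/negP/gU; rewrite ?inE.
  - by rewrite inE gside ?inE // cr.
  - have leT : #|T| <= n.*2.
      have -> : #|T| =
          #|[set x : T | c x == true]| + #|[set x : T | c x == false]|.
        rewrite -(cardC [set x : T | c x == true]); congr (_ + _).
        by apply: eq_card => x; rewrite !inE; case: (c x).
      by have := leclass true; have := leclass false; lia.
    exact: leq_trans (ltnW (card_copy_edges g treeT)) leT.
apply: (tree_growth r) => //.
  (* [w0] is only a default value for the map passed to [free] with the empty set. *)
  have [w0 _] : exists w0 : Knn n, w0 \in Knn_part n true.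
    apply/card_gt0P; rewrite card_part; have := leclass true; lia.
  have [||w [wl wgood _ _]] := free true set0 (fun=> w0) set0 r _ cr.
  - by rewrite inE.
  - by rewrite cards0.
  exists (fun=> w); split.
  - by move=> x y /set1P-> /set1P->.
  - by move=> x /set1P->; rewrite wl cr.
  - by [].
  - by move=> x y /set1P-> /set1P->; rewrite edge_irrefl.
move=> S x y rS xS yS exy nb [g [ginj gside ggood gU]].
have [w [wside wgood wN wfree]] :=
  free (c y) S g (used_nbrs U (g x)) y yS erefl (ggood x xS).
have SNy u : u \in S -> (u == y) = false.
  by move=> uS; apply/negP => /eqP uy; rewrite -uy uS in yS.
have wNg : {in S, forall u, g u != w}.
  move=> u uS; have [cu|/eqP cu] := eqVneq (c u) (c y); first exact: wfree.
  by apply/eqP => guw; apply: cu; rewrite -wside -guw gside.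
have xwU : [set g x; w] \notin U.
  by move: wN; rewrite inE /= /Knn_edge gside // wside cP.
exists (fun u => if u == y then w else g u); split.
- move=> a b /setU1P[->|aS] /setU1P[->|bS]; rewrite ?eqxx ?SNy //.
  + by move=> /esym/eqP; rewrite (negPf (wNg b bS)).
  + by move=> /eqP; rewrite (negPf (wNg a aS)).
  + exact: ginj.
- by move=> a /setU1P[->|aS]; rewrite ?eqxx ?SNy //; apply: gside.
- by move=> a /setU1P[->|aS]; rewrite ?eqxx ?SNy //; apply: ggood.
- move=> a b /setU1P[->|aS] /setU1P[->|bS]; rewrite ?eqxx ?SNy //.
  + by rewrite edge_irrefl.
  + by rewrite edge_sym => /nb->//; rewrite setUC.
  + by move=> /nb->.
  + exact: gU.
Qed.

(** * Packing the whole family *)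

Lemma pack_trees {n k d : nat} (T : 'I_k -> rooted_tree) :
    0 < d -> 0 < n -> k * n.*2 <= d * d ->
    (forall (i : 'I_k) (A : {set T i}),
       bipartition_class A -> #|A| + d.*2 <= n) ->
  exists f : forall i : 'I_k, T i -> Knn n, packing f /\
    forall i : 'I_k, f i (root_of (T i)) \in Knn_part n true.
Proof.
move=> d_gt0 n_gt0 lekn leA.
pose ok (f : forall i : 'I_k, T i -> Knn n) i := [/\ embedding (f i),
  f i (root_of (T i)) \in Knn_part n true & #|copy_edges (f i)| <= n.*2].
suff /(_ k (leqnn k)) [f [fok fdisj]] : forall j, j <= k ->
    exists f : forall i : 'I_k, T i -> Knn n,
      (forall i : 'I_k, i < j -> ok f i) /\
      (forall i i' : 'I_k, i < j -> i' < j -> i != i' ->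
         [disjoint copy_edges (f i) & copy_edges (f i')]).
  exists f; split=> [|i]; last by have [] := fok i (ltn_ord i).
  split=> [i|i i' ii']; first by have [] := fok i (ltn_ord i).
  exact: fdisj.
elim=> [_|j IHj lt_jk].
  (* A dummy family: at stage [j] only the maps of index below [j] are constrained. *)
  by exists (fun _ _ => inl (Ordinal n_gt0)); split.
have [f [fok fdisj]] := IHj (ltnW lt_jk).
pose U := \bigcup_(i : 'I_k | i < j) copy_edges (f i).
have leU : #|U| <= d * d.
  apply: leq_trans lekn.
  apply: (@leq_trans (\sum_(i : 'I_k | i < j) #|copy_edges (f i)|)).
    rewrite /U; elim/big_rec2: _ => [|i m A _ le_mA]; first by rewrite cards0.
    have := cardsU (copy_edges (f i)) A; lia.
  apply: (@leq_trans (\sum_(i : 'I_k) n.*2)).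
    rewrite [leqRHS](bigID (fun i : 'I_k => i < j)) /=.
    by apply: leq_trans (leq_addr _ _); apply: leq_sum => i /fok[].
  by rewrite sum_nat_const card_ord.
pose jj := Ordinal lt_jk.
have [g [gemb gdisj groot gcard]] :=
  embed_tree_avoiding (n := n) (d := d) U (T jj) d_gt0 leU (leA jj).
pose f' := dfwith f g.
have f'j : f' jj = g by rewrite /f' dfwith_in.
have f'N i : i != jj -> f' i = f i.
  by move=> ?; rewrite /f' dfwith_out // eq_sym.
have ltj (i : 'I_k) : i < j.+1 -> i != jj -> i < j.
  by rewrite ltnS leq_eqVlt => /predU1P[ij|//] /eqP[]; apply: val_inj.
have gdisjf (i : 'I_k) : i < j -> [disjoint copy_edges g & copy_edges (f i)].
  move=> lt_ij; by apply: disjointWr gdisj; apply: (bigcup_sup i).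
exists f'; split=> [i lt_ij|i i' lt_ij lt_i'j].
  have [->|iN] := eqVneq i jj; first by rewrite /ok f'j.
  by rewrite /ok f'N //; apply: fok; apply: ltj.
have [->|iN] := eqVneq i jj; have [->|i'N] := eqVneq i' jj.
- by [].
- by rewrite f'j f'N // => _; apply: gdisjf; apply: ltj.
- by rewrite f'j f'N // disjoint_sym => _; apply: gdisjf; apply: ltj.
- by rewrite !f'N // => ?; apply: fdisj => //; apply: ltj.
Qed.

(** * Choice of constants *)

Local Open Scope ring_scope.

Theorem theorem7 (R : realType) (gamma : R) (gamma_gt0 : 0 < gamma) :
  exists n0 : nat, forall n : nat, (n0 <= n)%N ->
  forall (k : nat) (T : 'I_k -> rooted_tree),
    k%:R <= n%:R `^ (2^-1 - gamma) ->
    (forall (i : 'I_k) (A : {set T i}),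
       bipartition_class A -> #|A|%:R <= (1 - gamma) * n%:R) ->
  exists f : forall i : 'I_k, T i -> Knn n,
    packing f /\
    exists s : bool, forall i : 'I_k, f i (root_of (T i)) \in Knn_part n s.
Proof.
(* The three summands yield [n >= 1], [gamma n >= 4] and [gamma^2 sqrt n >= 32]. *)
pose b : R := 1 + 4 / gamma + (32 / gamma ^+ 2) ^+ 2.
have g4_ge0 : 0 <= 4 / gamma by rewrite divr_ge0 // ltW.
have g32_ge0 : 0 <= 32 / gamma ^+ 2 by rewrite divr_ge0 // exprn_ge0 // ltW.
have b_ge0 : 0 <= b by rewrite /b !addr_ge0 // exprn_ge0.
exists (Num.truncn b).+1 => n le_n k T lek leA.
have lt_bn : b < n%:R.
  by apply: lt_le_trans (truncnS_gt _) _; rewrite ler_nat.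
have sq_ge0 : 0 <= (32 / gamma ^+ 2) ^+ 2 by rewrite exprn_ge0.
have n_ge1 : 1 <= n%:R :> R by rewrite /b in lt_bn; lra.
have gn_ge4 : 4 <= gamma * n%:R.
  by rewrite mulrC -ler_pdivrMr //; rewrite /b in lt_bn; lra.
have n_ge32 : (32 / gamma ^+ 2) ^+ 2 <= n%:R by rewrite /b in lt_bn; lra.
pose s : R := Num.sqrt n%:R.
have s2 : s ^+ 2 = n%:R by rewrite sqr_sqrtr.
have s_ge0 : 0 <= s by apply: sqrtr_ge0.
have s_ge32 : 32 <= s * gamma ^+ 2.
  rewrite -ler_pdivrMr ?exprn_gt0 //.
  by rewrite -(ler_pXn2r (n := 2)) ?nnegrE // s2.
have leks : k%:R <= s.
  apply: le_trans lek _; rewrite /s -powR12_sqrt //.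
  by apply: ler_powR => //; rewrite lerBlDr lerDl ltW.
(* The upper bound [2d <= gamma n] fits the slack of the classes; rounding down loses at most half
   since [gamma n / 2 >= 2], so [d >= gamma n / 4]. *)
pose d := Num.truncn (gamma * n%:R / 2).
have gn2_ge0 : 0 <= gamma * n%:R / 2 by lra.
have d_le : d%:R <= gamma * n%:R / 2 by rewrite /d truncn_le.
have d_ge : gamma * n%:R / 4 <= d%:R.
  have := truncnS_gt (gamma * n%:R / 2); rewrite -/d -(natr1 d); lra.
have d_gt0 : (0 < d)%N by rewrite -(ltr_nat R); lra.
have n_gt0 : (0 < n)%N by rewrite -(ltr_nat R); lra.
have [||f [fpack froot]] := pack_trees T d_gt0 n_gt0.
(* With [s = sqrt n], [2kn <= 2sn <= (gamma n / 4)^2 <= d^2]; the middle inequality is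
   [32 <= gamma^2 s] multiplied by [sn]. *)
- rewrite -(ler_nat R) !natrM -muln2 natrM.
  apply: (@le_trans _ _ ((gamma * n%:R / 4) * (gamma * n%:R / 4))); last first.
    by apply: ler_pM => //; lra.
  apply: (@le_trans _ _ (s * (n%:R * 2))); first by rewrite ler_wpM2r //; lra.
  have : 32 * (s * n%:R) <= (s * gamma ^+ 2) * (s * n%:R).
    by rewrite ler_wpM2r // mulr_ge0 //; lra.
  have -> : (s * gamma ^+ 2) * (s * n%:R) = (gamma * n%:R) * (gamma * n%:R).
    by rewrite -s2; ring.
  lra.
- move=> i A /leA leAi; rewrite -(ler_nat R) natrD -muln2 natrM.
  by rewrite mulrBl mul1r in leAi; lra.
- by exists f; split=> //; exists true.
Qed.
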